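(* For all integers $n\ge0$ and $\alpha\ge1$: \[ \overline{p}_{4}(2n)\equiv\overline{p}_{4}\bigl(2^{\alpha}(2n)\bigr) \pmod{4}, \] \[ \overline{p}_{4}(16n+10)\equiv 0 \pmod{8}, \] \[ \overline{p}_{4}\bigl(4^{\alpha}(8n+6)\bigr)\equiv 0 \pmod{16}, \] \[ \overline{p}_{4}(16n+14)\equiv 0 \pmod{32}, \] \[ \overline{p}_{4}\bigl(2^{\alpha}(16n+12)\bigr)\equiv 0 \pmod{32}, \] \[ \overline{p}_{4}(16n+12)\equiv 0 \pmod{256}, \] \[ \overline{p}_{4}(32n+28)\equiv 0 \pmod{512}. \]
   Context: For $k\ge1$ let $f_k=\prod_{m\ge1}(1-q^{km})$. $\overline{p}_4(n)$ denotes the number of 2-color overpartitions of $n$ (the first occurrence of a part of each color may be overlined) in which one of the two colors appears only in parts that are multiples of $4$; its generating function is $\sum_{n\ge0}\overline{p}_4(n)q^n=\dfrac{f_2f_{8}}{f_1^2f_4^2}$. *)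

(* Defs.v *)
From mathcomp Require Import all_boot.

Set Implicit Arguments.
Unset Strict Implicit.
Unset Printing Implicit Defensive.

(* Candidate 2-color overpartitions of n. The colors are false and true, and
   the index (c, i) stands for the parts of color c and size i.+1. Its value
   (m, o) gives the number m of such parts and whether the first of them is
   overlined. Sizes and multiplicities above n cannot occur. *)
Definition color_data (n : nat) := {ffun bool * 'I_n -> 'I_n.+1 * bool}.

Definition mult n (p : color_data n) (c : bool) (i : 'I_n) : nat := (p (c, i)).1.
Definition overlined n (p : color_data n) (c : bool) (i : 'I_n) : bool := (p (c, i)).2.

Definition weight n (p : color_data n) : nat :=
  \sum_(c : bool) \sum_(i < n) mult p c i * i.+1.

Definition is_overpartition n (p : color_data n) : bool :=
  (weight p == n) &&
  [forall c : bool, forall i : 'I_n, overlined p c i ==> (0 < mult p c i)].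

Definition true_color_multiples (l n : nat) (p : color_data n) : bool :=
  [forall i : 'I_n, (0 < mult p true i) ==> (l %| i.+1)].

Definition overp (l n : nat) : nat :=
  #|[set p : color_data n | is_overpartition p && true_color_multiples l p]|.

Definition overp4 (n : nat) : nat := overp 4 n.

(* Main.v *)
From HB Require Import structures.
Require Import Defs.
From mathcomp Require Import all_boot all_algebra.
From mathcomp Require Import zify ring.
From mathcomp Require boolp.

(** In the ring of formal power series, with [phi = \sum_(k : Z) q^(k^2)], the
    generating function is [1 / (phi(-q) phi(-q^4))]. This rests on Gauss's
    identity [phi(-q) = \prod_i (1 - q^i) / (1 + q^i)], which follows from
    Shanks's finite form by telescoping. Writing [O = 1 / phi(-q)], pairing the
    factors of the product gives [O(q) O(-q) = O(q^2)^2], hence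
    [O(q) = phi(q) O(q^2)^2]; together with [phi(q) = phi(q^4) + 2 q psi(q^8)]
    it also gives
    [phi(q)^2 = phi(q^2)^2 + 4 q phi(q^4) psi(q^8)].
    With the first relation every power of [O] becomes a power of [phi] times a
    series in [q^2], and with the second the even and odd parts of the powers of
    [phi^2] are explicit, each further factor of [q] costing a factor of [4].
    Hence each extraction of an even or odd part is again a polynomial in the
    same series with visible powers of [2], and [phi = O = 1] modulo [2]
    finishes each congruence. The families in [alpha] come from one induction:
    modulo [32], up to a term supported on exponents [1 %[mod 4]], taking even
    parts preserves the shape [phi^(2 c) O^(2 d)], whose coefficients at
    [4 n + 3] vanish. *)

Set Implicit Arguments.
Unset Strict Implicit.
Unset Printing Implicit Defensive.

Import GRing.Theory.

(** * Formal power series *)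

Section FormalSeries.
Local Open Scope ring_scope.

(** The wrapper keeps the Cauchy product apart from any pointwise structure on functions. Equality
    and choice on it are classical. *)
Record fps (R : Type) := Fps { fcoef :> nat -> R }.

Lemma fpsP (R : Type) (f g : fps R) : f =1 g -> f = g.
Proof. by case: f g => f [g] /= /boolp.funext ->. Qed.

HB.instance Definition _ (R : Type) := boolp.gen_eqMixin (fps R).
HB.instance Definition _ (R : Type) := boolp.gen_choiceMixin (fps R).

Variable R : comNzRingType.
Implicit Types f g h : fps R.

Definition fps_add f g : fps R := Fps (fun n => f n + g n).
Definition fps_opp f : fps R := Fps (fun n => - f n).
Definition fps_zero : fps R := Fps (fun=> 0).
Definition fps_one : fps R := Fps (fun n => (n == 0)%:R).
Definition fps_mul f g : fps R := Fps (fun n => \sum_(i < n.+1) f i * g (n - i)%N).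

Fact fps_addA : associative fps_add.
Proof. by move=> f g h; apply: fpsP => n /=; rewrite addrA. Qed.
Fact fps_addC : commutative fps_add.
Proof. by move=> f g; apply: fpsP => n /=; rewrite addrC. Qed.
Fact fps_add0 : left_id fps_zero fps_add.
Proof. by move=> f; apply: fpsP => n /=; rewrite add0r. Qed.
Fact fps_addN : left_inverse fps_zero fps_opp fps_add.
Proof. by move=> f; apply: fpsP => n /=; rewrite addNr. Qed.

HB.instance Definition _ :=
  GRing.isZmodule.Build (fps R) fps_addA fps_addC fps_add0 fps_addN.

(** A coefficient of a product sees only truncations, so commutativity and associativity can be
    borrowed from polynomials. *)
Lemma fps_mul_poly f g n k : (n < k)%N ->
  fps_mul f g n = ((\poly_(i < k) f i) * (\poly_(i < k) g i))`_n.
Proof.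
move=> nk; rewrite coefM /=; apply: eq_bigr => i _.
by rewrite !coef_poly !ifT //; have := ltn_ord i; lia.
Qed.

Fact fps_mulC : commutative fps_mul.
Proof.
by move=> f g; apply: fpsP => n; rewrite !(fps_mul_poly _ _ (ltnSn n)) mulrC.
Qed.

Fact fps_mulA : associative fps_mul.
Proof.
move=> f g h; apply: fpsP => n; pose p f := \poly_(i < n.+1) f i : {poly R}.
have lower u v : (fps_mul (fps_mul u v) h) n = (p u * p v * p h)`_n.
  rewrite coefM; apply: eq_bigr => i _.
  have iN := ltn_ord i.
  by rewrite (fps_mul_poly _ _ iN) /p coef_poly ifT //; lia.
have -> : fps_mul f (fps_mul g h) n = (p f * (p g * p h))`_n.
  rewrite coefM; apply: eq_bigr => i _.
  have iN := ltn_ord i.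
  by rewrite (@fps_mul_poly g h _ n.+1) /p ?coef_poly ?ifT //; lia.
by rewrite lower mulrA.
Qed.

Fact fps_mul1 : left_id fps_one fps_mul.
Proof.
move=> f; apply: fpsP => n /=; rewrite big_ord_recl /= mul1r subn0.
by rewrite big1 ?addr0 // => i _; rewrite mul0r.
Qed.

Fact fps_mulDl : left_distributive fps_mul fps_add.
Proof.
move=> f g h; apply: fpsP => n /=; rewrite -big_split.
by apply: eq_bigr => i _; rewrite mulrDl.
Qed.

Fact fps_one_neq0 : fps_one != 0.
Proof.
by apply/eqP => /(congr1 (fun f : fps R => f 0%N)) /= /eqP; rewrite oner_eq0.
Qed.

HB.instance Definition _ := GRing.Zmodule_isComNzRing.Build (fps R)
  fps_mulA fps_mulC fps_mul1 fps_mulDl fps_one_neq0.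

Lemma fpsD f g n : (f + g) n = f n + g n. Proof. by []. Qed.
Lemma fps0 n : (0 : fps R) n = 0. Proof. by []. Qed.
Lemma fps1 n : (1 : fps R) n = (n == 0)%:R. Proof. by []. Qed.
Lemma fpsM f g n : (f * g) n = \sum_(i < n.+1) f i * g (n - i)%N.
Proof. by []. Qed.

Lemma fpsMn f m n : (f *+ m) n = f n *+ m.
Proof. by elim: m => // m IH; rewrite !mulrS fpsD IH. Qed.

Lemma fpsMl_nat m f n : (m%:R * f) n = m%:R * f n.
Proof. by rewrite !mulr_natl fpsMn. Qed.

Lemma fps_sum (I : Type) (r : seq I) (P : pred I) (F : I -> fps R) n :
  (\sum_(i <- r | P i) F i) n = \sum_(i <- r | P i) F i n.
Proof. by elim/big_rec2: _ => //= i x y _ <-. Qed.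

Definition fq : fps R := Fps (fun n => (n == 1)%:R).

Lemma fqM f n : (fq * f) n = if n is n'.+1 then f n' else 0.
Proof.
rewrite fpsM; case: n => [|n]; first by rewrite big_ord1 mul0r.
rewrite 2!big_ord_recl /= mul0r add0r mul1r subSS subn0 big1 ?addr0 // => i _.
by rewrite mul0r.
Qed.

Lemma fqXM k f n : (fq ^+ k * f) n = if (n < k)%N then 0 else f (n - k)%N.
Proof.
elim: k n => [|k IH] [|n]; rewrite ?mul1r ?subn0 // exprS -mulrA fqM ?IH //.
Qed.

Lemma fqX k n : (fq ^+ k) n = (n == k)%:R.
Proof.
by rewrite -[_ ^+ _]mulr1 fqXM fps1; case: ltngtP => // h; rewrite ?h ?subnn // subn_eq0 leqNgt h.
Qed.

(** * The substitutions of [q^2] and [-q] for [q], and the parity parts *)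

Definition dilate f : fps R := Fps (fun n => if odd n then 0 else f n./2).
Definition alternate f : fps R := Fps (fun n => (-1) ^+ n * f n).
Definition evens f : fps R := Fps (fun n => f n.*2).
Definition odds f : fps R := Fps (fun n => f n.*2.+1).

Lemma dilateE f n : dilate f n = if odd n then 0 else f n./2. Proof. by []. Qed.
Lemma alternateE f n : alternate f n = (-1) ^+ n * f n. Proof. by []. Qed.
Lemma evensE f n : evens f n = f n.*2. Proof. by []. Qed.
Lemma oddsE f n : odds f n = f n.*2.+1. Proof. by []. Qed.

Lemma fps_parity f g : evens f = evens g -> odds f = odds g -> f = g.
Proof.
move=> e o; apply: fpsP => n; rewrite -(odd_double_half n).
case: (odd n); [have:= congr1 (fun h : fps R => h n./2) o|
                have:= congr1 (fun h : fps R => h n./2) e] => //.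
Qed.

Lemma evensD f g : evens (f + g) = evens f + evens g. Proof. exact: fpsP. Qed.
Lemma oddsD f g : odds (f + g) = odds f + odds g. Proof. exact: fpsP. Qed.
Lemma evens_dilate f : evens (dilate f) = f.
Proof. by apply: fpsP => n /=; rewrite odd_double doubleK. Qed.
Lemma odds_dilate f : odds (dilate f) = 0.
Proof. by apply: fpsP => n /=; rewrite odd_double. Qed.
Lemma evens_qdilate f : evens (fq * dilate f) = 0.
Proof.
by apply: fpsP => -[|n]; rewrite evensE ?doubleS fqM // dilateE /= odd_double.
Qed.
Lemma odds_qdilate f : odds (fq * dilate f) = f.
Proof.
by apply: fpsP => n; rewrite oddsE fqM dilateE odd_double doubleK.
Qed.

Lemma sum_parity (F : nat -> R) n :
  \sum_(i < n.*2) F i = \sum_(i < n) F i.*2 + \sum_(i < n) F i.*2.+1.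
Proof.
elim: n => [|n IH]; first by rewrite !big_ord0 addr0.
by rewrite doubleS !big_ord_recr /= IH; ring.
Qed.

(** A factor in [q^2] passes through the extraction of a parity part. Products below are therefore
    first rewritten with as many factors in [q^2] as possible. *)
Lemma evens_dilateM f g : evens (dilate f * g) = f * evens g.
Proof.
apply: fpsP => n; rewrite evensE !fpsM big_ord_recr /=.
rewrite (sum_parity (fun i => dilate f i * g (n.*2 - i)%N)) /=.
rewrite [X in _ + X + _]big1 ?addr0; last by move=> i _; rewrite odd_double mul0r.
rewrite odd_double doubleK big_ord_recr /= !subnn; congr (_ + _).
by apply: eq_bigr => i _; rewrite odd_double doubleK doubleB.
Qed.

Lemma odds_dilateM f g : odds (dilate f * g) = f * odds g.
Proof.
apply: fpsP => n; rewrite oddsE !fpsM -doubleS.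
rewrite (sum_parity (fun i => dilate f i * g (n.*2.+1 - i)%N)) /=.
rewrite [X in _ + X]big1 ?addr0; last by move=> i _; rewrite odd_double mul0r.
apply: eq_bigr => i _; rewrite odd_double doubleK doubleB subSn //.
by rewrite leq_double -ltnS.
Qed.

Lemma fps_split f : f = dilate (evens f) + fq * dilate (odds f).
Proof.
apply: fps_parity; rewrite ?evensD ?oddsD.
  by rewrite evens_dilate evens_qdilate addr0.
by rewrite odds_dilate odds_qdilate add0r.
Qed.

Fact dilate_is_additive : zmod_morphism dilate.
Proof. by move=> f g; apply: fpsP => n /=; case: odd; rewrite ?subrr. Qed.

Fact dilate_is_monoid_morphism : monoid_morphism dilate.
Proof.
split=> [|f g]; first by apply: fpsP => -[|[|n]] //=; case: odd.
apply: fps_parity; rewrite ?evens_dilateM ?odds_dilateM !(evens_dilate, odds_dilate) //.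
by rewrite mulr0.
Qed.

HB.instance Definition _ :=
  GRing.isZmodMorphism.Build (fps R) (fps R) dilate dilate_is_additive.
HB.instance Definition _ :=
  GRing.isMonoidMorphism.Build (fps R) (fps R) dilate dilate_is_monoid_morphism.

Lemma dilateD f g : dilate (f + g) = dilate f + dilate g. Proof. exact: rmorphD. Qed.
Lemma dilateM f g : dilate (f * g) = dilate f * dilate g. Proof. exact: rmorphM. Qed.
Lemma dilateX f k : dilate (f ^+ k) = dilate f ^+ k. Proof. exact: rmorphXn. Qed.
Lemma dilate_nat k : dilate k%:R = k%:R. Proof. exact: rmorph_nat. Qed.

Fact alternate_is_additive : zmod_morphism alternate.
Proof. by move=> f g; apply: fpsP => n /=; rewrite mulrBr. Qed.

Fact alternate_is_monoid_morphism : monoid_morphism alternate.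
Proof.
split=> [|f g]; first by apply: fpsP => -[|n] //=; rewrite ?mulr0 ?mul1r.
apply: fpsP => n; rewrite alternateE !fpsM big_distrr; apply: eq_bigr => i _.
have e : (-1) ^+ n = (-1) ^+ i * (-1) ^+ (n - i) :> R.
  by rewrite -exprD subnKC // -ltnS.
by rewrite e [LHS]mulrACA.
Qed.

HB.instance Definition _ :=
  GRing.isZmodMorphism.Build (fps R) (fps R) alternate alternate_is_additive.
HB.instance Definition _ :=
  GRing.isMonoidMorphism.Build (fps R) (fps R) alternate
    alternate_is_monoid_morphism.

Fact evens_is_additive : zmod_morphism evens. Proof. by move=> f g; apply: fpsP. Qed.
Fact odds_is_additive : zmod_morphism odds. Proof. by move=> f g; apply: fpsP. Qed.
HB.instance Definition _ :=
  GRing.isZmodMorphism.Build (fps R) (fps R) evens evens_is_additive.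
HB.instance Definition _ :=
  GRing.isZmodMorphism.Build (fps R) (fps R) odds odds_is_additive.

Lemma dilate_fq : dilate fq = fq ^+ 2.
Proof.
apply: fpsP => n; rewrite fqX /=; case: ifPn => [|/negbTE e].
  by case: n => [|[|[|]]].
by rewrite -(odd_double_half n) e add0n doubleK; case: n./2 => [|[|]].
Qed.

Lemma alternate_fq : alternate fq = - fq.
Proof.
by apply: fpsP => -[|[|n]] /=; rewrite ?mulr0 ?oppr0 // expr1 mulr1.
Qed.

Lemma alternate_dilate f : alternate (dilate f) = dilate f.
Proof.
apply: fpsP => n /=; case: ifPn; rewrite ?mulr0 // => /negbTE.
by rewrite -signr_odd => ->; rewrite mul1r.
Qed.

(** Equality modulo [q^N], which stands in for convergence of infinite products. *)
Definition agree N f g := forall k, (k < N)%N -> f k = g k.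

Lemma agree_trans N f g h : agree N f g -> agree N g h -> agree N f h.
Proof. by move=> fg gh k kN; rewrite fg ?gh. Qed.

Lemma agree_leq M N f g : (M <= N)%N -> agree N f g -> agree M f g.
Proof. by move=> MN fg k kM; apply: fg; lia. Qed.

Lemma agreeM N f f' g g' : agree N f f' -> agree N g g' -> agree N (f * g) (f' * g').
Proof.
move=> ff gg k kN; rewrite !fpsM; apply: eq_bigr => i _.
by rewrite ff ?gg //; have := ltn_ord i; lia.
Qed.

Lemma agree_dilate N f g : agree N f g -> agree N (dilate f) (dilate g).
Proof. by move=> fg k kN /=; rewrite fg //; lia. Qed.

Lemma agree_fqX N k f : (N <= k)%N -> agree N (fq ^+ k * f) 0.
Proof. by move=> Nk j jN; rewrite fqXM fps0 ifT //; lia. Qed.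

End FormalSeries.

(** * Gauss's identity and the dissections of [phi] *)

Section Theta.
Local Open Scope ring_scope.

Notation ser := (fps int).
Notation q := (fq int).

(** The expansion of [1 / (1 - q^i)] for positive [i]. *)
Definition geom i : ser := Fps (fun n => (i %| n)%:R).

Lemma geomE i : (0 < i)%N -> (1 - q ^+ i) * geom i = 1.
Proof.
move=> i0; apply/eqP; rewrite mulrBl mul1r subr_eq; apply/eqP.
apply: fpsP => n; rewrite fpsD fps1 fqXM /=; case: ltnP => [ni | le_in].
  rewrite addr0; case: n ni => [|n] ni; first by rewrite dvdn0.
  by case: eqP => // _; rewrite gtnNdvd.
rewrite dvdn_subl //.
by case: n le_in => [|n]; [lia | rewrite add0r].
Qed.

Definition overfactor i : ser := (1 + q ^+ i) * geom i.

Lemma agree_overfactor i : (0 < i)%N -> agree i (overfactor i) 1.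
Proof.
move=> i0; have g : geom i = 1 + q ^+ i * geom i.
  by rewrite -(geomE i0); ring.
have -> : overfactor i = 1 + q ^+ i * (1 + geom i + q ^+ i * geom i).
  rewrite /overfactor {1}g; ring.
by move=> k ki; rewrite fpsD (agree_fqX _ (leqnn i)) // addr0.
Qed.

Definition overprod N : ser := \prod_(i < N) overfactor i.+1.

Lemma overprodS N : overprod N.+1 = overprod N * overfactor N.+1.
Proof. exact: big_ord_recr. Qed.

(** The infinite product, read off its diagonal: factors of index above [n] do not change
    coefficient [n]. *)
Definition overseries : ser := Fps (fun n => overprod n n).

Lemma agree_prod (F : nat -> ser) N M : (forall i, agree i.+1 (F i) 1) ->
  (N <= M)%N -> agree N.+1 (\prod_(i < M) F i) (\prod_(i < N) F i).
Proof.
move=> F1; elim: M => [|M IH]; first by case: N.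
rewrite leq_eqVlt => /predU1P[-> // | NM].
apply: agree_trans (IH NM); rewrite big_ord_recr -[X in agree _ _ X]mulr1.
by apply: agreeM => //; apply: agree_leq NM (F1 M).
Qed.

Lemma agree_overprod N M : (N <= M)%N -> agree N.+1 (overprod M) overseries.
Proof.
move=> NM k kN; apply: (@agree_prod (fun i => overfactor i.+1) k) => //; last by lia.
by move=> i; exact: agree_overfactor.
Qed.

(* The right-hand side of Shanks's identity is the value at [x = q^(m+1)]. *)
Definition square_part (x : ser) m : ser :=
  1 + 2%:R * \sum_(s < m) (-1) ^+ s.+1 * overprod s * geom s.+1 * x ^+ s.+1.

Lemma square_partS x m : square_part x m.+1 = square_part x m
  + 2%:R * ((-1) ^+ m.+1 * overprod m * geom m.+1 * x ^+ m.+1).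
Proof. by rewrite /square_part big_ord_recr mulrDr addrA. Qed.

(* The differences in [m] telescope, the numerators of consecutive terms being
   [-(1 - q^m) - x (1 + q^m)]. *)
Lemma square_part_telescope x m :
  (1 - x) * square_part (x * q) m - (1 + x) * square_part x m =
  - 2%:R * (-1) ^+ m * x ^+ m.+1 * overprod m.
Proof.
elim: m => [|m IH].
  by rewrite /square_part !big_ord0 /overprod big_ord0 expr1; ring.
rewrite !square_partS overprodS /overfactor.
have gE := geomE (ltn0Sn m).
move: (square_part _ _) (square_part _ _) (geom _) (overprod _) IH gE => S T g p.
rewrite exprMn !exprS => IH gE; move: IH gE.
move: (x ^+ m) (q ^+ m) ((-1) ^+ m) => xm qm e IH gE.
apply/eqP; rewrite -subr_eq0; apply/eqP.
(* A combination of the relations [IH] and [gE], each moved to one side. *)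
transitivity ((1 - x) * T - (1 + x) * S - (- 2%:R * e * (x * xm) * p)
   + 2%:R * e * x * xm * p * ((1 - q * qm) * g - 1)); first by ring.
by rewrite IH gE; ring.
Qed.

Definition theta_sum N : ser :=
  1 + 2%:R * \sum_(s < N) (-1) ^+ s.+1 * q ^+ (s.+1 ^ 2).

(** Shanks's finite form. The telescoped relation at [x = q^(N+1)] moves the argument of
    [square_part] to [q^(N+2)], and [square_partS] supplies the one further term. *)
Lemma theta_sum_overprod N :
  theta_sum N * overprod N = square_part (q ^+ N.+1) N.
Proof.
elim: N => [|N IH].
  by rewrite /theta_sum /square_part /overprod !big_ord0; ring.
have -> : theta_sum N.+1 = theta_sum N + 2%:R * (-1) ^+ N.+1 * q ^+ (N.+1 ^ 2).
  by rewrite /theta_sum big_ord_recr /=; ring.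
rewrite square_partS.
have := square_part_telescope (q ^+ N.+1) N; rewrite -exprSr -IH -exprM mulnn.
rewrite overprodS /overfactor => tel.
have -> : (q ^+ N.+2) ^+ N.+1 = q ^+ N.+1 * q ^+ (N.+1 ^ 2).
  by rewrite -exprM -exprD; congr (_ ^+ _); lia.
have gE := geomE (ltn0Sn N).
move: (square_part _ _) (theta_sum N) (overprod N) (geom _) tel gE => S T p g.
rewrite [(-1) ^+ N.+1]exprS.
move: (q ^+ _) ((-1) ^+ N) (q ^+ _) => x e y tel gE.
apply/eqP; rewrite -subr_eq0; apply/eqP.
transitivity (g * (- 2%:R * e * x * p - ((1 - y) * S - (1 + y) * (T * p)))
   + S * ((1 - y) * g - 1)); first by ring.
by rewrite tel gE; ring.
Qed.

Definition is_square n := [exists k : 'I_n.+1, k ^ 2 == n]%N.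

Lemma is_squareP n : reflect (exists k, k ^ 2 = n)%N (is_square n).
Proof.
apply: (iffP existsP) => [[k /eqP e] | [k e]]; first by exists k.
have kn : (k < n.+1)%N by rewrite -e; nia.
by exists (Ordinal kn); apply/eqP.
Qed.

(** A nonzero square counts twice, for its two roots in [Z]. *)
Definition phi : ser :=
  Fps (fun n => if n == 0%N then 1 else if is_square n then 2 else 0).

Lemma fps_signM k (f : ser) n : ((-1) ^+ k * f) n = (-1) ^+ k * f n.
Proof. by rewrite -signr_odd -[in RHS]signr_odd; case: odd; rewrite ?mulN1r ?mul1r. Qed.

(** The signs match because [s] and [s^2] have the same parity. *)
Lemma theta_sumE N k :
  theta_sum N k = if (k < N.+1 ^ 2)%N then alternate phi k else 0.
Proof.
elim: N k => [|N IH] k.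
  rewrite /theta_sum big_ord0 mulr0 addr0 fps1.
  by case: k => [|k]; rewrite ?alternateE //= ltnS ltn0.
have -> : theta_sum N.+1 = theta_sum N + 2%:R * ((-1) ^+ N.+1 * q ^+ (N.+1 ^ 2)).
  by rewrite /theta_sum big_ord_recr /=; ring.
rewrite fpsD IH fpsMl_nat fps_signM fqX !alternateE /=.
have e2 : (N.+2 ^ 2 = N.+1 ^ 2 + 2 * N + 3)%N by rewrite -!mulnn; lia.
have e1 : (0 < N.+1 ^ 2)%N by rewrite expn_gt0.
case: (ltngtP k (N.+1 ^ 2)%N) => [lt | gt | ->].
- have -> : (k < N.+2 ^ 2)%N by lia.
  by rewrite !mulr0 addr0.
(* Here [k] exceeds [(N+1)^2]; below [(N+2)^2] it lies strictly between consecutive squares. *)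
- rewrite mulr0 mulr0 addr0; case: ltnP => // le.
  rewrite ifF; last by apply/eqP; lia.
  rewrite ifF ?mulr0 //; apply/is_squareP => -[j jk].
  by move: gt le; rewrite -jk !ltn_exp2r; lia.
- rewrite add0r mulr1 mulrC ifT; last by lia.
  rewrite gtn_eqF // ifT; last by apply/is_squareP; exists N.+1.
  by rewrite -signr_odd -[in RHS]signr_odd oddX orFb.
Qed.

(** Gauss's identity. Modulo [q^(n+1)] the right-hand side of the finite form is [1], as each of its
    other terms contains a positive power of [q^(n+1)]. *)
Lemma phi_overseries : alternate phi * overseries = 1.
Proof.
apply: fpsP => n; transitivity ((theta_sum n * overprod n) n).
  apply: (@agreeM _ n.+1) => // k kn; last by rewrite (agree_overprod (leqnn n) kn).
  by rewrite theta_sumE ifT // -mulnn; lia.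
rewrite theta_sum_overprod.
have: agree n.+1 (square_part (q ^+ n.+1) n) 1; last by apply.
move=> k kn; rewrite /square_part fpsD -[RHS]addr0; congr (_ + _).
rewrite fpsMl_nat fps_sum big1 ?mulr0 // => i _.
by rewrite mulrC exprS -!mulrA (agree_fqX _ (leqnn n.+1)).
Qed.

Lemma dilate_overfactor i : dilate (overfactor i) = overfactor i.*2.
Proof.
rewrite /overfactor rmorphM rmorphD rmorph1 rmorphXn /= dilate_fq -exprM mul2n.
congr (_ * _); apply: fpsP => n; rewrite dilateE /= -muln2.
case: ifPn => [nodd | neven].
  by case: dvdnP => // -[k nk]; move: nodd; rewrite nk mulnA oddM andbF.
by rewrite -[n in RHS](even_halfK neven) -muln2 dvdn_pmul2r.
Qed.

(** Under [q -> -q] a factor of odd index becomes its inverse and one of even index is unchanged, so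
    exactly the squares of the even-indexed factors survive. *)
Lemma overprod_alternate N :
  alternate (overprod N.*2) * overprod N.*2 = dilate (overprod N) ^+ 2.
Proof.
elim: N => [|N IH]; first by rewrite /overprod !big_ord0 !rmorph1 expr1n mulr1.
have w2 : overfactor N.*2.+2 = dilate (overfactor N.+1).
  by rewrite dilate_overfactor doubleS.
have w1 : alternate (overfactor N.*2.+1) * overfactor N.*2.+1 = 1.
  have gE := geomE (ltn0Sn N.*2).
  have qE : alternate (q ^+ N.*2.+1) = - q ^+ N.*2.+1.
    by rewrite rmorphXn /= alternate_fq exprNn -signr_odd /= odd_double mulN1r.
  have agE : (1 + q ^+ N.*2.+1) * alternate (geom N.*2.+1) = 1.
    by have := congr1 (@alternate int) gE; rewrite rmorphM rmorphB /= !rmorph1 qE opprK.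
  rewrite /overfactor rmorphM rmorphD rmorph1 /= qE.
  move: gE agE; move: (q ^+ _) (geom _) (alternate _) => x g g' gE agE.
  rewrite [LHS](_ : _ = ((1 - x) * g) * ((1 + x) * g')); first by rewrite gE agE mulr1.
  by ring.
move: w2 w1; rewrite doubleS !overprodS.
move: (overfactor _) (overfactor _) (overfactor _) => w w' _ -> w1.
rewrite !rmorphM /= alternate_dilate exprMn -IH.
transitivity (alternate (overprod N.*2) * overprod N.*2 * dilate w' ^+ 2
  * (alternate w * w)); first by ring.
by rewrite w1 mulr1.
Qed.

Lemma alternateK : involutive (@alternate int).
Proof.
by move=> f; apply: fpsP => n; rewrite !alternateE mulrA -exprMn mulrNN mulr1 expr1n mul1r.
Qed.

(** Multiply [O(q) O(-q) = O(q^2)^2] by [phi(q)], the inverse of [O(-q)]. *)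
Lemma overseries_alternate : overseries = phi * dilate overseries ^+ 2.
Proof.
have E : alternate overseries * overseries = dilate overseries ^+ 2.
  apply: fpsP => n; have n2 : (n <= n.*2)%N by lia.
  transitivity ((alternate (overprod n.*2) * overprod n.*2) n).
    apply: (@agreeM _ n.+1) => // k kn; by rewrite ?alternateE (agree_overprod n2 kn).
  rewrite overprod_alternate !expr2; apply: (@agreeM _ n.+1) => //;
   by apply: agree_dilate; exact: agree_overprod.
have := phi_overseries; move/(congr1 (@alternate int)).
rewrite rmorphM rmorph1 /=.
by rewrite alternateK => e; rewrite -E mulrA e mul1r.
Qed.

Lemma phiE n : phi n = (if n == 0%N then 1 else if is_square n then 2 else 0).
Proof. by []. Qed.

(** * Squares modulo 8 and the dissections of [phi] and [phi^2] *)

Lemma is_square_mul4 n : is_square (4 * n) = is_square n.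
Proof.
apply/is_squareP/is_squareP => -[k e]; last first.
  by exists (2 * k)%N; rewrite expnMn e.
exists k./2; have := odd_double_half k; case: odd; move: k./2 => j; nia.
Qed.

Lemma is_square_mod4 n : is_square n -> (n %% 4 < 2)%N.
Proof.
move=> /is_squareP[k <-]; have := odd_double_half k.
by case: odd; move: k./2 => j; nia.
Qed.

Lemma is_square_odd_mod8 n : odd n -> is_square n -> (n %% 8 = 1)%N.
Proof.
move=> n_odd /is_squareP[k e]; move: n_odd; rewrite -e oddX /= => k_odd.
have := odd_double_half k; rewrite k_odd; move: k./2 => j <-.
have -> : ((true + j.*2) ^ 2 = j * j.+1 * 4 + 1)%N by rewrite -mulnn; lia.
have /dvdnP[m ->] : (2 %| j * j.+1)%N by rewrite dvdn2 oddM /=; case: odd.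
by rewrite -mulnA modnMDl.
Qed.

Lemma evens_phi : evens phi = dilate phi.
Proof.
apply: fpsP => n; rewrite evensE dilateE !phiE.
case: (boolP (odd n)) => [n_odd | n_even].
  rewrite ifF; last by lia.
  by rewrite ifF //; apply/idP => /is_square_mod4; lia.
have -> : (n.*2 = 4 * n./2)%N by lia.
by rewrite is_square_mul4 muln_eq0.
Qed.

(** The series of triangular numbers: [n] is triangular exactly when [8n + 1] is a square. *)
Definition psi : ser := Fps (fun n => (is_square (8 * n + 1))%:R).

(** An odd square is 1 modulo 8, so [2n + 1] can be a square only when 4 divides [n]. *)
Lemma odds_phi : odds phi = 2%:R * dilate (dilate psi).
Proof.
apply: fpsP => n; rewrite oddsE fpsMl_nat !dilateE phiE /=.
have square_mod8 := @is_square_odd_mod8 n.*2.+1 (_ : odd n.*2.+1).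
case: (boolP (odd n)) => [n_odd | n_even].
  by rewrite ifF ?mulr0 //; apply/idP => /square_mod8; lia.
case: (boolP (odd n./2)) => [n_odd | n2_even].
  by rewrite ifF ?mulr0 //; apply/idP => /square_mod8; lia.
have -> : (n.*2.+1 = 8 * n./2./2 + 1)%N by lia.
by case: is_square; rewrite ?mulr0 ?mulr1.
Qed.

Lemma phi_dissection : phi = dilate (dilate phi) + 2%:R * q * dilate (dilate (dilate psi)).
Proof.
rewrite [LHS]fps_split evens_phi odds_phi rmorphM rmorph_nat; ring.
Qed.

Lemma phi_sqr_dissection :
  phi ^+ 2 = dilate (phi ^+ 2) + 4%:R * q * dilate (dilate phi * dilate (dilate psi)).
Proof.
(* This is [O(q) = phi(q) O(q^2)^2] turned around by [phi(-q) O(q) = 1]. *)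
have phi_alt : phi * alternate phi = dilate (alternate phi) ^+ 2.
  have sO := phi_overseries; have := congr1 (@dilate int) sO.
  rewrite rmorphM rmorph1 /= => dsO.
  rewrite -[LHS]mulr1 -(expr1n _ 2) -dsO exprMn.
  rewrite [LHS](_ : _ = alternate phi * (phi * dilate overseries ^+ 2)
    * dilate (alternate phi) ^+ 2); last by ring.
  by rewrite -overseries_alternate sO mul1r.
(* Inserting [phi_dissection] into [phi_alt] gives a difference of squares, a series in [q^2];
   injectivity of [dilate] then lets [q] replace [q^2]. *)
have alt_sqr : alternate phi ^+ 2 = dilate phi ^+ 2 - 4%:R * q * dilate (dilate psi) ^+ 2.
  apply: (can_inj (@evens_dilate int)).
  rewrite rmorphXn /= -phi_alt [X in alternate X]phi_dissection.
  rewrite rmorphD !rmorphM /= !alternate_dilate alternate_fq {1}phi_dissection.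
  rewrite rmorphB !(rmorphXn, rmorphM) /= dilate_fq !rmorph_nat.
  by ring.
have phi_sqr : phi ^+ 2 = dilate phi ^+ 2 + 4%:R * q * dilate (dilate psi) ^+ 2.
  have := congr1 (@alternate int) alt_sqr.
  rewrite rmorphXn /= alternateK => ->.
  rewrite rmorphB !(rmorphXn, rmorphM) /= !alternate_dilate alternate_fq !rmorph_nat.
  by ring.
(* Squaring [phi_dissection], the two squares add up to [phi(q^2)^2] by [phi_sqr] at [q^2], and the
   cross term is the odd part. *)
rewrite {2}phi_sqr {1}phi_dissection rmorphD !(rmorphXn, rmorphM) /= dilate_fq !rmorph_nat.
by ring.
Qed.

End Theta.

(** * Congruences *)

Section Congruences.
Local Open Scope ring_scope.

Notation ser := (fps int).
Notation q := (fq int).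
Notation O := overseries.

Definition cong (m : nat) (f g : ser) := exists z, f = g + m%:R * z.

Lemma cong_refl m f : cong m f f.
Proof. by exists 0; rewrite mulr0 addr0. Qed.

Lemma cong_trans m f g h : cong m f g -> cong m g h -> cong m f h.
Proof. by move=> [z ->] [t ->]; exists (t + z); ring. Qed.

Lemma congD m f f' g g' : cong m f f' -> cong m g g' -> cong m (f + g) (f' + g').
Proof. by move=> [z ->] [t ->]; exists (z + t); ring. Qed.

Lemma congM m f f' g g' : cong m f f' -> cong m g g' -> cong m (f * g) (f' * g').
Proof. by move=> [z ->] [t ->]; exists (z * g' + f' * t + m%:R * z * t); ring. Qed.

Lemma congX m f g k : cong m f g -> cong m (f ^+ k) (g ^+ k).
Proof. by move=> fg; elim: k => [|k IH]; rewrite ?exprS; [exact: cong_refl|exact: congM]. Qed.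

(** Visible powers of 2 raise the modulus: the cofactor then matters only modulo a small power of
    2. *)
Lemma cong_scale k m f g : cong m f g -> cong (k * m) (k%:R * f) (k%:R * g).
Proof. by move=> [z ->]; exists z; rewrite natrM; ring. Qed.

Lemma cong_dvd m d f g : (d %| m)%N -> cong m f g -> cong d f g.
Proof. by move=> /dvdnP[k ->] [z ->]; exists (k%:R * z); rewrite natrM; ring. Qed.

Lemma cong_dilate m f g : cong m f g -> cong m (dilate f) (dilate g).
Proof. by move=> [z ->]; exists (dilate z); rewrite rmorphD rmorphM rmorph_nat. Qed.

Lemma evens_nat m (f : ser) : evens (m%:R * f) = m%:R * evens f.
Proof. by rewrite !mulr_natl raddfMn. Qed.

Lemma odds_nat m (f : ser) : odds (m%:R * f) = m%:R * odds f.
Proof. by rewrite !mulr_natl raddfMn. Qed.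

Lemma cong_evens m f g : cong m f g -> cong m (evens f) (evens g).
Proof. by move=> [z ->]; exists (evens z); rewrite evensD evens_nat. Qed.

Lemma cong_odds m f g : cong m f g -> cong m (odds f) (odds g).
Proof. by move=> [z ->]; exists (odds z); rewrite oddsD odds_nat. Qed.

Lemma cong_coef m f g : cong m f g -> forall n, exists c, f n = g n + m%:R * c.
Proof. by move=> [z ->] n; exists (z n); rewrite fpsD fpsMl_nat. Qed.

Lemma phi_mod2 : cong 2 phi 1.
Proof.
exists (Fps (fun n => if n == 0%N then 0 else (is_square n)%:R)).
apply: fpsP => n; rewrite phiE fpsD fps1 fpsMl_nat /=.
by case: eqP; case: is_square.
Qed.

Lemma overseries_mod2 : cong 2 O 1.
Proof.
have [z phiz] := phi_mod2; exists (- (alternate z * O)).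
have := phi_overseries; rewrite phiz rmorphD rmorphM !rmorph1 rmorph_nat /= => sO.
by rewrite -[X in X + _]sO; ring.
Qed.

Lemma sqr_mod4 f : cong 2 f 1 -> cong 4 (f ^+ 2) 1.
Proof. by move=> [z ->]; exists (z + z ^+ 2); ring. Qed.

(** * Parity parts of powers of [phi^2] *)

Notation x := (phi ^+ 2).
Notation y := (O ^+ 2).
Notation b := (phi * dilate psi).

Lemma y_dilate : y = x * dilate y ^+ 2.
Proof. by rewrite {1}overseries_alternate rmorphXn; ring. Qed.

Lemma x_dissection : x = dilate x + 4%:R * q * dilate (dilate b).
Proof. by rewrite [in dilate b]rmorphM /=; exact: phi_sqr_dissection. Qed.

(** The binomial expansion, whose terms of degree three and more in [4 v] are multiples of 64. The
    exponent [e.+2] avoids truncated subtraction. *)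
Lemma exprDM4 (R : comPzRingType) (u v : R) e : exists z,
  (u + 4%:R * v) ^+ e.+2 = u ^+ e.+2 + 4%:R * e.+2%:R * u ^+ e.+1 * v
    + 16%:R * 'C(e.+2, 2)%:R * u ^+ e * v ^+ 2 + 64%:R * z.
Proof.
elim: e => [|e [z IH]]; first by exists 0; rewrite binn; ring.
(* The new multiple of 64 is [4 v] times the quadratic term. *)
exists ('C(e.+2, 2)%:R * u ^+ e * v ^+ 3 + (u + 4%:R * v) * z).
rewrite exprS IH (binS e.+2 1) bin1 natrD -[e.+3]add1n (natrD _ 1) !exprS; ring.
Qed.

(** Modulo 64 the linear term of the expansion is the whole odd part; the quadratic term carries
    [q^2] and joins the even part. *)
Lemma x_pow e : exists z,
  x ^+ e.+2 = dilate (x ^+ e.+2)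
    + (q * dilate (4%:R * e.+2%:R * x ^+ e.+1 * dilate b)
    + dilate (16%:R * 'C(e.+2, 2)%:R * q * x ^+ e * dilate b ^+ 2)) + 64%:R * z.
Proof.
have [z xE] := exprDM4 (dilate x) (q * dilate (dilate b)) e.
exists z; rewrite {1}x_dissection -mulrA xE; congr (_ + _).
move: (phi ^+ 2) (dilate b) => u v.
rewrite !(rmorphM, rmorphXn, rmorph_nat) /= dilate_fq !exprS.
move: (dilate u) (dilate v) => u' v'; move: (u' ^+ e) => w; move: (e.+2%:R) ('C(_, _)%:R) => n m.
by ring.
Qed.

Lemma evens_x_pow e :
  cong 64 (evens (x ^+ e.+2))
    (x ^+ e.+2 + 16%:R * 'C(e.+2, 2)%:R * q * x ^+ e * dilate b ^+ 2).
Proof.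
have [z zE] := x_pow e; exists (evens z); rewrite {1}zE.
by rewrite !evensD evens_nat !evens_dilate evens_qdilate add0r.
Qed.

Lemma odds_x_pow e :
  cong 64 (odds (x ^+ e.+2)) (4%:R * e.+2%:R * x ^+ e.+1 * dilate b).
Proof.
have [z zE] := x_pow e; exists (odds z); rewrite {1}zE.
by rewrite !oddsD odds_nat !odds_dilate odds_qdilate add0r addr0.
Qed.

(** [O(q)] is [f_2 / f_1^2] and [O(q^4)] is [f_8 / f_4^2]. *)
Definition gf4 : ser := O * dilate (dilate O).

Lemma evens_gf4 : evens gf4 = dilate (phi * O ^+ 5) * x.
Proof.
(* Two uses of [O = phi O(q^2)^2] turn [O(q)] into [phi(q) phi(q^2)^2 O(q^4)^4]. *)
have -> : gf4 = dilate (x * dilate O ^+ 5) * phi.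
  rewrite /gf4 {1}overseries_alternate [in dilate O ^+ 2]overseries_alternate.
  by rewrite !(rmorphM, rmorphXn) /=; ring.
by rewrite evens_dilateM evens_phi !(rmorphM, rmorphXn) /=; ring.
Qed.

Lemma phi_overseries5 : phi * O ^+ 5 = x ^+ 3 * dilate y ^+ 5.
Proof. by rewrite {1}overseries_alternate rmorphXn /=; ring. Qed.

(** The classical [r_2(2n) = r_2(n)] for sums of two squares. *)
Lemma evens_x : evens x = x.
Proof.
by rewrite {1}x_dissection -mulrA evensD evens_nat evens_dilate evens_qdilate mulr0 addr0.
Qed.

Lemma odds_x : odds x = 4%:R * dilate b.
Proof.
by rewrite {1}x_dissection -mulrA oddsD odds_nat odds_dilate odds_qdilate add0r.
Qed.

Lemma evens_evens_gf4 : evens (evens gf4) = x ^+ 4 * dilate y ^+ 5.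
Proof. by rewrite evens_gf4 evens_dilateM evens_x phi_overseries5; ring. Qed.

Lemma odds_evens_gf4 : odds (evens gf4) = 4%:R * (dilate (b * y ^+ 5) * x ^+ 3).
Proof.
rewrite evens_gf4 odds_dilateM odds_x phi_overseries5 !(rmorphM, rmorphXn) /=; ring.
Qed.

Lemma b_mod2 : cong 2 b (dilate psi).
Proof. by rewrite -[X in cong _ _ X]mul1r; apply: congM phi_mod2 (cong_refl _ _). Qed.

Lemma x_pow_mod4 e : cong 4 (x ^+ e) 1.
Proof. by rewrite -(expr1n _ e); apply/congX/sqr_mod4/phi_mod2. Qed.

Lemma y_pow_mod4 e : cong 4 (y ^+ e) 1.
Proof. by rewrite -(expr1n _ e); apply/congX/sqr_mod4/overseries_mod2. Qed.

Lemma gf4_2n_mod4 n : (0 < n)%N -> exists c, gf4 (2 * n)%N = 4%:R * c.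
Proof.
move=> n0; rewrite mul2n -evensE -(odd_double_half n); case: (boolP (odd n)) => n_odd.
  by rewrite -oddsE odds_evens_gf4 fpsMl_nat; eexists.
rewrite add0n -evensE evens_evens_gf4.
have: cong 4 (x ^+ 4 * dilate y ^+ 5) 1.
  rewrite -[X in cong _ _ X](mulr1 1); apply: congM (x_pow_mod4 4) _.
  by rewrite -rmorphXn -(rmorph1 (@dilate int)); apply/cong_dilate/y_pow_mod4.
move=> /cong_coef/(_ n./2)[c ->]; exists c.
(* Positivity of [n] excludes the constant coefficient. *)
by rewrite fps1 (_ : _ == _ = false) ?add0r //; lia.
Qed.

Lemma cong_x_y_pow i j : cong 4 (x ^+ i * y ^+ j) 1.
Proof.
by rewrite -[X in cong _ _ X](mulr1 1); apply: congM (x_pow_mod4 i) (y_pow_mod4 j).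
Qed.

(** Modulo 8 the indices [4m + 2] give [4 psi(q^4)], in which the exponent [m = 4n + 2] does not
    occur. *)
Lemma gf4_16n10_mod8 n : exists c, gf4 (16 * n + 10)%N = 8%:R * c.
Proof.
have -> : (16 * n + 10 = (n.*2.+1).*2.*2.+1.*2)%N by lia.
rewrite -evensE -oddsE -evensE -oddsE odds_evens_gf4.
have: cong 8 (4%:R * (dilate (b * y ^+ 5) * x ^+ 3)) (4%:R * dilate (dilate psi)).
  apply: (@cong_scale 4 2); rewrite -[X in cong _ _ X]mulr1.
  apply: congM (cong_dilate _) (cong_dvd _ (x_pow_mod4 3)) => //.
  rewrite -[X in cong _ _ X]mulr1.
  exact: congM b_mod2 (cong_dvd _ (y_pow_mod4 5)).
move/cong_evens/cong_odds/cong_coef/(_ n) => [c ->]; exists c.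
by rewrite evens_nat odds_nat evens_dilate odds_dilate mulr0 fps0 add0r.
Qed.

(** Modulo 32 the indices [8m + 6] give [16 psi(q^2) psi(q^4)], which has no odd exponents. *)
Lemma gf4_16n14_mod32 n : exists c, gf4 (16 * n + 14)%N = 32%:R * c.
Proof.
have -> : (16 * n + 14 = (n.*2.+1).*2.+1.*2.+1.*2)%N by lia.
rewrite -evensE -!oddsE odds_evens_gf4 odds_nat odds_dilateM.
have odds3 : cong 8 (odds (x ^+ 3)) (4%:R * (1 * dilate b)).
  apply: cong_trans (cong_dvd (isT : 8 %| 64)%N (odds_x_pow 1)) _.
  rewrite [X in cong _ X](_ : _ = 4%:R * (3%:R * x ^+ 2 * dilate b)); last by ring.
  apply: (@cong_scale 4 2); apply: congM; last exact: cong_refl.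
  rewrite -[X in cong _ _ X](mulr1 1).
  by apply: congM (cong_dvd _ (x_pow_mod4 2)); [exists 1; ring | ].
have: cong 32 (4%:R * (b * y ^+ 5 * odds (x ^+ 3)))
    (16%:R * dilate (psi * dilate psi)).
  apply: (@cong_trans _ _ (4%:R * (b * y ^+ 5 * (4%:R * (1 * dilate b))))).
    exact: (@cong_scale 4 8) (congM (cong_refl _ _) odds3).
  rewrite [X in cong _ X](_ : _ = 16%:R * (b * y ^+ 5 * dilate b)); last by ring.
  apply: (@cong_scale 16 2); rewrite [dilate (psi * _)]rmorphM.
  rewrite -[dilate psi as X in cong _ _ (X * _)]mulr1.
  apply: congM; last exact: cong_dilate b_mod2.
  exact: congM b_mod2 (cong_dvd _ (y_pow_mod4 5)).
move/cong_odds/cong_coef/(_ n) => [c ->]; exists c.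
by rewrite odds_nat odds_dilate mulr0 fps0 add0r.
Qed.

(** * The families in [alpha] *)

Lemma y_pow_dilate k : y ^+ k = x ^+ k * dilate (y ^+ (2 * k)).
Proof. by rewrite {1}y_dilate exprMn -[dilate y ^+ 2 ^+ _]exprM [dilate (y ^+ _)]rmorphXn. Qed.

(** Everything but a power of [x] is now in [q^2], so only the parity parts of that power are
    needed. *)
Lemma phi_over_pow_dilate c d :
  x ^+ c.+2 * y ^+ d.+1 = dilate (y ^+ (2 * d.+1)) * x ^+ (c + d.+1).+2.
Proof.
rewrite (y_pow_dilate d.+1).
by rewrite [LHS]mulrA -exprD addSn addSn mulrC.
Qed.

Lemma b_sqr_mod2 : cong 2 (dilate b ^+ 2) (dilate (dilate (psi ^+ 2))).
Proof. by rewrite !rmorphXn /=; apply/congX/cong_dilate/b_mod2. Qed.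

(** The shape [x^C y^D] is kept, [(C, D)] becoming [(C + D, 2 D)]; the error comes from the
    quadratic term of [evens_x_pow] and lives on exponents 1 modulo 4. *)
Lemma evens_phi_over_pow c d : exists k,
  cong 32 (evens (x ^+ c.+2 * y ^+ d.+1))
    (x ^+ (c + d.+1).+2 * y ^+ (2 * d.+1)
     + 16%:R * (k%:R * (q * dilate (dilate (psi ^+ 2))))).
Proof.
set e := (c + d.+1)%N; exists 'C(e.+2, 2).
rewrite phi_over_pow_dilate evens_dilateM -/e.
apply: cong_trans (congM (cong_refl _ _) (cong_dvd _ (evens_x_pow e))) _ => //.
rewrite mulrDr mulrC; apply: congD (cong_refl _ _) _.
move: ('C(_, _)%:R) => k.
rewrite [X in cong _ X](_ : _ =
  16%:R * (k * (q * (x ^+ e * y ^+ (2 * d.+1) * dilate b ^+ 2)))); last by ring.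
apply: (@cong_scale 16 2); do 2!apply: congM (cong_refl _ _) _.
rewrite -[X in cong _ _ X]mul1r; apply: congM b_sqr_mod2.
exact: cong_dvd (cong_x_y_pow _ _).
Qed.

(** Each odd part brings 4 times the current exponent of [x]. The two exponents [e + 2] and [g + 2]
    have opposite parity, so 32 divides [16 (e + 2) (g + 2)]. *)
Lemma odds_odds_phi_over_pow c d : cong 32 (odds (odds (x ^+ c.+2 * y ^+ d.+1))) 0.
Proof.
set e := (c + d.+1)%N.
have: cong 32 (odds (x ^+ c.+2 * y ^+ d.+1))
    (y ^+ (2 * d.+1) * (4%:R * e.+2%:R * x ^+ e.+1 * dilate b)).
  rewrite phi_over_pow_dilate odds_dilateM -/e.
  by apply: congM (cong_refl _ _) (cong_dvd _ (odds_x_pow e)).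
move/cong_odds => /cong_trans; apply.
(* Expanding [y^(2(d+1))] by [y_pow_dilate] adds [2(d+1)] to the exponent [e + 1] of [x], which
   makes [g + 2]. *)
pose g := (e.+1 + 2 * d)%N.
have -> : y ^+ (2 * d.+1) * (4%:R * e.+2%:R * x ^+ e.+1 * dilate b)
  = (4 * e.+2)%:R * (dilate (b * y ^+ (2 * (2 * d.+1))) * x ^+ g.+2).
  have -> : g.+2 = (2 * d.+1 + e.+1)%N by rewrite /g; lia.
  rewrite (y_pow_dilate (2 * d.+1)) natrM [dilate (b * _)]dilateM exprD.
  by move: (e.+2%:R) (x ^+ _) (x ^+ _) (dilate b) (dilate (y ^+ _)) => *; ring.
rewrite odds_nat odds_dilateM.
have [z ->] := odds_x_pow g.
have /dvdnP[k kE] : (32 %| 4 * e.+2 * (4 * g.+2))%N.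
  have : (2 %| e.+2 * g.+2)%N
    by rewrite dvdn2 oddM (_ : odd g.+2 = ~~ odd e.+2) ?andbN // /g; lia.
  by case/dvdnP=> k ke; apply/dvdnP; exists k; lia.
exists (b * y ^+ (2 * (2 * d.+1)) * (k%:R * x ^+ g.+1 * dilate b + 8%:R * e.+2%:R * z)).
have := congr1 (fun n : nat => n%:R : ser) kE.
rewrite /= !natrM add0r => kE'.
transitivity (b * y ^+ (2 * (2 * d.+1)) * (4%:R * e.+2%:R * (4%:R * g.+2%:R)
    * x ^+ g.+1 * dilate b + 4%:R * e.+2%:R * 64%:R * z)).
  by move: (e.+2%:R) (g.+2%:R) => ? ?; ring.
by rewrite kE'; move: (e.+2%:R) (k%:R) => ? ?; ring.
Qed.

Lemma q_dilate_dilate (f : ser) m :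
  (m %% 4 != 1)%N -> (q * dilate (dilate f)) m = 0.
Proof.
by case: m => [|m] m4; rewrite fqM ?dilateE //; do 2!case: ifPn => //; lia.
Qed.

Lemma phi_over_pow_mod32 c d k n : exists t,
  (x ^+ c.+2 * y ^+ d.+1) (2 ^ k * (4 * n + 3))%N = 32%:R * t.
Proof.
elim: k c d => [|k IH] c d.
  have -> : (2 ^ 0 * (4 * n + 3) = n.*2.+1.*2.+1)%N by lia.
  rewrite -!oddsE; have [t ->] := cong_coef (odds_odds_phi_over_pow c d) n.
  by exists t; rewrite fps0 add0r.
rewrite expnS -mulnA mul2n -evensE.
have [j /cong_coef H] := evens_phi_over_pow c d.
have [t ->] := H (2 ^ k * (4 * n + 3))%N.
have [s sE] := IH (c + d.+1)%N (2 * d).+1; rewrite fpsD fpsMl_nat fpsMl_nat.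
have -> : (2 * d.+1 = (2 * d).+2)%N by lia.
rewrite sE q_dilate_dilate; first by exists (s + t); ring.
(* [2^k (4n + 3)] is 3 modulo 4 or even, hence off the support of the error term. *)
by case: k {IH H sE} => [|k]; rewrite ?expnS; lia.
Qed.

Lemma evens3_gf4_mod32 : cong 32 (evens (evens (evens gf4))) (x ^+ 4 * y ^+ 5).
Proof.
rewrite evens_evens_gf4 mulrC -rmorphXn /= evens_dilateM mulrC.
apply: congM; last exact: cong_refl.
apply: cong_trans (cong_dvd (isT : 32 %| 64)%N (evens_x_pow 2)) _.
(* The quadratic coefficient [16 * 6 = 96] is [32 * 3]. *)
by exists (3%:R * q * x ^+ 2 * dilate b ^+ 2); rewrite (_ : 'C(4, 2) = 6)%N //; ring.
Qed.

Lemma gf4_8_pow2_mod32 k n : exists c, gf4 (8 * (2 ^ k * (4 * n + 3)))%N = 32%:R * c.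
Proof.
have -> m : (8 * m = m.*2.*2.*2)%N by lia.
rewrite -!evensE; have [c ->] := cong_coef evens3_gf4_mod32 (2 ^ k * (4 * n + 3))%N.
by have [t ->] := phi_over_pow_mod32 2 4 k n; exists (t + c); ring.
Qed.

(** The value is [256 psi(q^2)^3] modulo 512: the factor 256 settles [16n + 12], and the absence of
    odd exponents settles [32n + 28]. *)
Lemma odds_odds_evens_evens_gf4_mod512 :
  cong 512 (odds (odds (evens (evens gf4)))) (256%:R * dilate (psi ^+ 3)).
Proof.
(* The cubic term, with coefficient 256, counts modulo 512, so the fourth power is expanded
   exactly. *)
have odds4 : odds (x ^+ 4) =
    16%:R * (x ^+ 3 * dilate b) + 256%:R * (q * (x * dilate b ^+ 3)).
  have -> : x ^+ 4 = dilate (x ^+ 4 + 96%:R * q * x ^+ 2 * dilate b ^+ 2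
        + 256%:R * q ^+ 2 * dilate b ^+ 4)
      + q * dilate (16%:R * x ^+ 3 * dilate b + 256%:R * q * x * dilate b ^+ 3).
    rewrite {1}x_dissection; move: x (dilate b) => u v.
    rewrite !dilateD !(dilateM, dilateX, dilate_nat) dilate_fq.
    by ring.
  by rewrite oddsD odds_dilate odds_qdilate; ring.
rewrite evens_evens_gf4 mulrC -rmorphXn /= odds_dilateM odds4.
(* In the first term [y^5 = x^5 y(q^2)^10] raises [x^3] to [x^8], whose odd part has the factor
   [4 * 8 = 32]. *)
have -> : y ^+ 5 * (16%:R * (x ^+ 3 * dilate b) + 256%:R * (q * (x * dilate b ^+ 3)))
  = 16%:R * (dilate (y ^+ 10 * b) * x ^+ 8)
    + 256%:R * (x * y ^+ 5 * (q * dilate (b ^+ 3))).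
  rewrite mulrDr {1}(y_pow_dilate 5) [dilate (_ * b)]dilateM [dilate (b ^+ 3)]dilateX.
  rewrite -[(2 * 5)%N]/10%N.
  by move: (dilate b) (dilate (y ^+ _)) => u v; ring.
rewrite oddsD !odds_nat odds_dilateM -[X in cong _ _ X]add0r; apply: congD.
  rewrite -(mulr0 16%:R); apply: (@cong_scale 16 32).
  rewrite -(mulr0 (y ^+ 10 * b)).
  apply: congM (cong_refl _ _) _.
  apply: cong_trans (cong_dvd (isT : 32 %| 64)%N (odds_x_pow 6)) _.
  by exists (x ^+ 7 * dilate b); ring.
apply: (@cong_scale 256 2).
have: cong 2 (x * y ^+ 5 * (q * dilate (b ^+ 3))) (1 * (q * dilate (dilate (psi ^+ 3)))).
  apply: congM; first exact: cong_dvd (cong_x_y_pow 1 5).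
  apply: congM (cong_refl _ _) (cong_dilate _).
  by rewrite [dilate (psi ^+ 3)]rmorphXn; exact: congX b_mod2.
by move/cong_odds; rewrite mul1r odds_qdilate.
Qed.

Lemma gf4_16n12_mod256 n : exists c, gf4 (16 * n + 12)%N = 256%:R * c.
Proof.
have -> : (16 * n + 12 = n.*2.+1.*2.+1.*2.*2)%N by lia.
rewrite -!(evensE, oddsE); have [c ->] := cong_coef odds_odds_evens_evens_gf4_mod512 n.
by rewrite fpsMl_nat; exists (dilate (psi ^+ 3) n + 2%:R * c); ring.
Qed.

Lemma gf4_32n28_mod512 n : exists c, gf4 (32 * n + 28)%N = 512%:R * c.
Proof.
have -> : (32 * n + 28 = n.*2.+1.*2.+1.*2.+1.*2.*2)%N by lia.
rewrite -!(evensE, oddsE); have [c ->] := cong_coef (cong_odds odds_odds_evens_evens_gf4_mod512) n.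
by rewrite odds_nat odds_dilate mulr0 fps0 add0r; exists c.
Qed.

End Congruences.

(** * The generating function *)

Section GeneratingFunction.
Local Open Scope ring_scope.

Notation ser := (fps int).
Notation q := (fq int).

Definition allowed (c : bool) (i m : nat) (o : bool) :=
  (o ==> (0 < m)%N) && (c ==> (0 < m)%N ==> (4 %| i)%N).

Definition part_series n (c : bool) (i : nat) : ser :=
  \sum_(mo : 'I_n.+1 * bool) (allowed c i mo.1 mo.2)%:R * q ^+ (mo.1 * i).

Lemma agree_geom_sum n i : (0 < i)%N ->
  agree n.+1 (\sum_(m < n.+1) q ^+ (m * i)) (geom i).
Proof.
move=> i0 k kn; rewrite fps_sum /=.
under eq_bigr do rewrite fqX.
case: dvdnP => [[m km] | nd].
  have mn : (m < n.+1)%N by nia.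
  rewrite (bigD1 (Ordinal mn)) //= km eqxx big1 ?addr0 // => j /eqP jm.
  rewrite eqn_pmul2r //; case: eqP => // mj.
  by case: jm; apply: val_inj.
by rewrite big1 // => j _; case: eqP => // kj; case: nd; exists j.
Qed.

Definition part_factor (c : bool) i := if c && ~~ (4 %| i)%N then 1 else overfactor i.

(** A positive multiplicity allows both overline states and multiplicity 0 only one, whence the
    [- 1]. *)
Lemma part_seriesE n c i : part_series n c i =
  if c && ~~ (4 %| i)%N then 1 else 2%:R * (\sum_(m < n.+1) q ^+ (m * i)) - 1.
Proof.
rewrite /part_series.
rewrite -(pair_bigA _ (fun (m : 'I_n.+1) o => (allowed c i m o)%:R * q ^+ (m * i))) /=.
under eq_bigr do rewrite big_bool /allowed /=.
case: (boolP (c && _)) => [/andP[-> /negbTE n4] | n4].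
  rewrite n4 big_ord_recl /= mul0r mul1r add0r big1 ?addr0 // => m _.
  by rewrite !mul0r addr0.
have {n4} c4 m : c ==> m ==> (4 %| i)%N by move: n4; case: c; case: m => //= /negPn.
under eq_bigr do rewrite c4 !andbT.
rewrite !big_ord_recl /= mulrDr big_distrr /=.
rewrite (eq_bigr (fun j : 'I_n => 2%:R * q ^+ (bump 0 j * i))); last by move=> j _; ring.
by ring.
Qed.

Lemma agree_part_series n c i : (0 < i)%N ->
  agree n.+1 (part_series n c i) (part_factor c i).
Proof.
move=> i0 k kn; rewrite part_seriesE /part_factor; case: ifP => // _.
have -> : overfactor i = 2%:R * geom i - 1 by rewrite /overfactor -[X in _ - X](geomE i0); ring.
by rewrite !fpsD !fpsMl_nat (agree_geom_sum i0 kn).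
Qed.

(** Distributing the product over the sums gives one term per element of [color_data n]: a 0/1
    admissibility factor times [q] to its weight. *)
Lemma overp4_coef n :
  (overp4 n)%:R = (\prod_(ci : bool * 'I_n) part_series n ci.1 ci.2.+1) n.
Proof.
rewrite /part_series bigA_distr_bigA /= fps_sum /overp4 /overp.
rewrite -sum1_card natr_sum big_mkcond /=; apply: eq_bigr => p _.
rewrite inE big_split /= prodrXr.
have -> : (\sum_(ci : bool * 'I_n) (p ci).1 * ci.2.+1)%N = weight p.
  by rewrite /weight pair_big; apply: eq_bigr => -[].
have -> : \prod_(ci : bool * 'I_n) (allowed ci.1 ci.2.+1 (p ci).1 (p ci).2)%:R
    = [forall ci : bool * 'I_n, allowed ci.1 ci.2.+1 (p ci).1 (p ci).2]%:R :> ser.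
  case: (boolP [forall _, _]) => [/forallP all_allowed | ].
    by rewrite big1 // => ci _; rewrite all_allowed.
  by rewrite negb_forall => /existsP[ci /negbTE ciN]; rewrite (bigD1 ci) //= ciN mul0r.
rewrite -fpsM fpsMl_nat fqX (eq_sym n) -natrM mulnb [[forall _, _] && _]andbC.
have -> : is_overpartition p && true_color_multiples 4 p =
    (weight p == n) && [forall ci : bool * 'I_n, allowed ci.1 ci.2.+1 (p ci).1 (p ci).2].
  rewrite /is_overpartition -andbA; congr (_ && _).
  apply/andP/forallP => [[/forallP over /forallP mul4] [c i] | all_allowed].
    rewrite /allowed /=; have /forallP/(_ i) -> := over c.
    by case: c => //=; exact: mul4.
  split; last by apply/forallP => i; case/andP: (all_allowed (true, i)).
  by apply/forallP => c; apply/forallP => i; case/andP: (all_allowed (c, i)).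
by case: (_ && _).
Qed.

(** Each block of four consecutive sizes contains one multiple of 4, and the factor of size [4j] is
    that of size [j] at [q^4]. *)
Lemma prod_part_factor_true n :
  \prod_(i < 4 * n) part_factor true i.+1 = dilate (dilate (overprod n)).
Proof.
elim: n => [|n IH]; first by rewrite /overprod muln0 !big_ord0 !rmorph1.
rewrite mulnS addnC !addnS addn0 !big_ord_recr /= IH overprodS.
rewrite (dilateM (overprod n)) (dilateM (dilate (overprod n))).
rewrite !dilate_overfactor /part_factor /=.
have n4 j : (0 < j < 4)%N -> (4 %| 4 * n + j)%N = false by lia.
rewrite -![(4 * n).+1]addn1 -!addnS.
rewrite (n4 1%N) // (n4 2%N) // (n4 3%N) // !mulr1 ifF; last by lia.
by congr (_ * overfactor _); lia.
Qed.

Lemma overp4_gf4 n : (overp4 n)%:R = gf4 n.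
Proof.
have E : \prod_(ci : bool * 'I_n) part_series n ci.1 ci.2.+1
    = (\prod_(i < n) part_series n false i.+1) * \prod_(i < n) part_series n true i.+1.
  rewrite -(pair_bigA _ (fun c (i : 'I_n) => part_series n c i.+1)) /=.
  by rewrite big_bool mulrC.
have agree_colour c : agree n.+1 (\prod_(i < n) part_series n c i.+1)
    (\prod_(i < n) part_factor c i.+1).
  elim/big_rec2: _ => // i f g _ fg.
  by apply: agreeM => //; exact: agree_part_series.
rewrite overp4_coef E; apply: (@agreeM _ n.+1) (ltnSn n).
  by apply: agree_trans (agree_colour _) _; apply: agree_overprod.
apply: agree_trans (agree_colour _) _.
(* Lengthening the product to [4 n] sizes leaves the coefficients up to [n] alone and makes complete
   blocks of four. *)
apply: (@agree_trans _ _ _ (\prod_(i < 4 * n) part_factor true i.+1)).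
  move=> k kn; symmetry; apply: (@agree_prod (fun i => part_factor true i.+1) n) => //; last by lia.
  by move=> i; rewrite /part_factor; case: ifP => // _; exact: agree_overfactor.
rewrite prod_part_factor_true.
by do 2!apply: agree_dilate; exact: agree_overprod.
Qed.

End GeneratingFunction.

(** * From coefficients of the series to residues of [overp4] *)

Lemma mod_of_gf4 k m : (exists c, gf4 m = k%:R * c)%R -> overp4 m = 0 %[mod k].
Proof.
move=> [c gE]; apply/eqP; rewrite mod0n; change (k %| overp4 m).
have : (k%:Z %| (overp4 m)%:Z)%Z.
  by rewrite -[X in (_ %| X)%Z]natz overp4_gf4 gE natz dvdz_mulr.
by rewrite dvdzE.
Qed.

Theorem theorem4p1 (n alpha : nat) (halpha : 1 <= alpha) :
  overp4 (2 * n) = overp4 (2 ^ alpha * (2 * n)) %[mod 4] /\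
  overp4 (16 * n + 10) = 0 %[mod 8] /\
  overp4 (4 ^ alpha * (8 * n + 6)) = 0 %[mod 16] /\
  overp4 (16 * n + 14) = 0 %[mod 32] /\
  overp4 (2 ^ alpha * (16 * n + 12)) = 0 %[mod 32] /\
  overp4 (16 * n + 12) = 0 %[mod 256] /\
  overp4 (32 * n + 28) = 0 %[mod 512].
Proof.
case: alpha halpha => // a _; split.
  (* At [n = 0] both arguments are 0; otherwise both values are divisible by 4. *)
  case: (posnP n) => [-> | n0]; first by rewrite !muln0.
  have mod4 m : 0 < m -> overp4 (2 * m) = 0 %[mod 4].
    by move=> m0; apply/mod_of_gf4/gf4_2n_mod4.
  by rewrite mulnCA !mod4 // muln_gt0 expn_gt0.
split; first exact/mod_of_gf4/gf4_16n10_mod8.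
split.
  (* The argument belongs to the family treated modulo 32, and 16 divides 32. *)
  have -> : 4 ^ a.+1 * (8 * n + 6) = 8 * (2 ^ (2 * a) * (4 * n + 3)).
    by rewrite (expnS 4) (expnM 2 2 a) -[2 ^ 2]/4; lia.
  have /mod_of_gf4 := gf4_8_pow2_mod32 (2 * a) n.
  rewrite !mod0n => /eqP d32; apply/eqP; exact: (dvdn_trans (isT : 16 %| 32) d32).
split; first exact/mod_of_gf4/gf4_16n14_mod32.
split.
  have -> : 2 ^ a.+1 * (16 * n + 12) = 8 * (2 ^ a * (4 * n + 3)) by rewrite expnS; lia.
  exact/mod_of_gf4/gf4_8_pow2_mod32.
split; first exact/mod_of_gf4/gf4_16n12_mod256.
exact/mod_of_gf4/gf4_32n28_mod512.
Qed.
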